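(* For $t\ge2$ put $a=\frac{-t-\sqrt{t^2-4}}{2}$, $b=\frac{-t+\sqrt{t^2-4}}{2}$ and let $\mu_t\in V_{3,8}$ be defined by $$J_{\mu_t}(xZ_1+yZ_2+zZ_3)=\begin{bmatrix}0&0&ax&0&0&y&0&z\\0&0&0&bx&y&0&-z&0\\-ax&0&0&0&0&z&y&0\\0&-bx&0&0&z&0&0&y\\0&-y&0&-z&0&0&0&x\\-y&0&-z&0&0&0&x&0\\0&z&-y&0&0&-x&0&0\\-z&0&0&-y&-x&0&0&0\end{bmatrix}.$$ Then $\mu_t$, $t\ge2$, is a $1$-parameter family of pairwise non-isomorphic nonsingular algebras admitting nilsolitons, with Pfaffian forms given by $$f_{\mu_t}(x,y,z)=x^4+y^4+z^4+t\,x^2y^2.$$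
   Context: Let $\mathfrak{n}=\mathfrak{n}_1\oplus\mathfrak{n}_2$ be a real inner product space with $\mathfrak{n}_1\perp\mathfrak{n}_2$ and orthonormal bases $\{X_1,\dots,X_8\}$ of $\mathfrak{n}_1$, $\{Z_1,Z_2,Z_3\}$ of $\mathfrak{n}_2$. $V_{3,8}=\Lambda^2\mathfrak{n}_1^*\otimes\mathfrak{n}_2$ is the space of bilinear skew-symmetric maps $\mu:\mathfrak{n}_1\times\mathfrak{n}_1\to\mathfrak{n}_2$, each regarded as a $2$-step nilpotent Lie bracket on $\mathfrak{n}$ (with $\mathfrak{n}_2$ central) and determined by the linear map $J_\mu:\mathfrak{n}_2\to\mathfrak{so}(\mathfrak{n}_1)$, $\langle J_\mu(Z)X,Y\rangle=\langle\mu(X,Y),Z\rangle$ (matrices are with respect to $\{X_i\}$). $\mu$ is nonsingular if $J_\mu(Z)$ is invertible for all $Z\neq0$. Isomorphic means isomorphic as Lie algebras. Pfaffian form: $f_\mu(x,y,z)=\operatorname{Pf}(J_\mu(xZ_1+yZ_2+zZ_3))$, where $\operatorname{Pf}:\mathfrak{so}(\mathfrak{n}_1)\to\mathbb{R}$ is the polynomial function with $\operatorname{Pf}(B)^2=\det B$ and $\operatorname{Pf}(J_0)=1$ for a fixed $J_0\in\mathfrak{so}(\mathfrak{n}_1)$ having only $\pm\mathrm{i}$ as eigenvalues; the choice of $J_0$ only affects the overall sign, which is here taken (uniformly in $t$) so that the form is positive. $(\mathfrak{n},\mu)$ admits a nilsoliton if there is an inner product on $\mathfrak{n}$ such that the corresponding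 left-invariant Riemannian metric $g$ on the simply connected nilpotent Lie group with Lie algebra $(\mathfrak{n},\mu)$ is a Ricci soliton, i.e. the Ricci flow solution starting at $g$ evolves only by time-dependent scaling and pull-back by diffeomorphisms; in this setting this is known to be equivalent to: the Ricci operator of $g$ equals $cI+D$ for some $c\in\mathbb{R}$ and some derivation $D$ of $(\mathfrak{n},\mu)$. *)

(* Defs.v *)
From HB Require Import structures.
From mathcomp Require Import all_boot all_order all_algebra.
From mathcomp Require Import reals complex.
From mathcomp Require mpoly.

Set Implicit Arguments.
Unset Strict Implicit.
Unset Printing Implicit Defensive.

Import Order.TTheory GRing.Theory Num.Theory.
Local Open Scope ring_scope.

(* The vectors of R^n are columns, so that matrices act on the left.  The    *)
(* given orthonormal bases identify n_1 with R^8, n_2 with R^3 and           *)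
(* n = n_1 + n_2 with R^(8 + 3); a vector of n is col_mx X Z.                *)

Definition basis_vec (R : realType) (n : nat) (i : 'I_n) : 'cV[R]_n :=
  delta_mx i 0.

Definition dot (R : realType) (n : nat) (X Y : 'cV[R]_n) : R :=
  \sum_i X i 0 * Y i 0.

Definition skew_mx (R : realType) (n : nat) (B : 'M[R]_n) : Prop := B^T = - B.

Section LieAlgebra.
Variables (R : realType) (n : nat).
Implicit Types (br : 'cV[R]_n -> 'cV[R]_n -> 'cV[R]_n) (U V W : 'cV[R]_n).

Definition is_lie_bracket br : Prop :=
  [/\ forall V, linear (br^~ V),
      forall U, linear (br U),
      forall U, br U U = 0 &
      forall U V W, br U (br V W) + br V (br W U) + br W (br U V) = 0].

Definition lie_isomorphic br br' : Prop :=
  exists phi : 'M[R]_n, phi \in unitmx /\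
    forall U V, phi *m br U V = br' (phi *m U) (phi *m V).

Definition derivation br (D : 'M[R]_n) : Prop :=
  forall U V, D *m br U V = br (D *m U) V + br U (D *m V).

(* All tensors below are evaluated on left-invariant vector fields, i.e. on  *)
(* elements of the Lie algebra.                                              *)

Implicit Types (ip : 'cV[R]_n -> 'cV[R]_n -> R)
  (nabla : 'cV[R]_n -> 'cV[R]_n -> 'cV[R]_n).

Definition inner_product ip : Prop :=
  [/\ forall U, scalar (ip U),
      forall U V, ip U V = ip V U &
      forall U, U != 0 -> 0 < ip U U].

(* In the metric condition, the derivative of the constant function          *)
(* ip V W along U vanishes.                                                  *)
Definition levi_civita br ip nabla : Prop :=
  [/\ forall V, linear (nabla^~ V),
      forall U, linear (nabla U),
      forall U V, nabla U V - nabla V U = br U V &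
      forall U V W, ip (nabla U V) W + ip V (nabla U W) = 0].

Definition curvature br nabla U V W : 'cV[R]_n :=
  nabla U (nabla V W) - nabla V (nabla U W) - nabla (br U V) W.

Definition trace_fun (f : 'cV[R]_n -> 'cV[R]_n) : R :=
  \sum_i f (basis_vec R i) i 0.

Definition ricci_tensor br nabla V W : R :=
  trace_fun (fun U => curvature br nabla U V W).

Definition ricci_operator br ip (Ric : 'M[R]_n) : Prop :=
  exists2 nabla, levi_civita br ip nabla &
    forall V W, ip (Ric *m V) W = ricci_tensor br nabla V W.

Definition admits_nilsoliton br : Prop :=
  exists ip, inner_product ip /\
  exists Ric, ricci_operator br ip Ric /\
  exists (c : R) (D : 'M[R]_n), derivation br D /\ Ric = c%:M + D.

End LieAlgebra.

Section V38.
Variable R : realType.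
Implicit Types mu : 'cV[R]_8 -> 'cV[R]_8 -> 'cV[R]_3.

Definition V38 mu : Prop :=
  [/\ forall Y, linear (mu^~ Y),
      forall X, linear (mu X) &
      forall X Y, mu X Y = - mu Y X].

Definition bracket mu (U V : 'cV[R]_(8 + 3)) : 'cV[R]_(8 + 3) :=
  col_mx 0 (mu (usubmx U) (usubmx V)).

Lemma bracket_lie mu : V38 mu -> is_lie_bracket (bracket mu).
Proof.
case=> linl linr skew.
have mu0r X : mu X 0 = 0.
  by have := linr X (-1) 0 0; rewrite scaler0 addr0 scaleN1r addNr.
split=> [V a U W|U a V W|U|U V W]; rewrite /bracket.
- by rewrite linearP /= linl scale_col_mx add_col_mx scaler0 addr0.
- by rewrite linearP /= linr scale_col_mx add_col_mx scaler0 addr0.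
- suff -> : mu (usubmx U) (usubmx U) = 0 by rewrite col_mx0.
  apply/matrixP => i j; rewrite mxE.
  have /matrixP/(_ i j) := skew (usubmx U) (usubmx U).
  rewrite mxE => /eqP; rewrite -subr_eq0 opprK -mulr2n mulrn_eq0 /=.
  by move/eqP.
- by rewrite !col_mxKu !mu0r !col_mx0 !addr0.
Qed.

(* The (i, j) entry is <J_mu(Z) X_j, X_i> = <mu(X_j, X_i), Z>.               *)
Definition J mu (Z : 'cV[R]_3) : 'M[R]_8 :=
  \matrix_(i, j) dot (mu (basis_vec R j) (basis_vec R i)) Z.

Lemma dot_suml n (I : finType) (F : I -> 'cV[R]_n) Y :
  dot (\sum_i F i) Y = \sum_i dot (F i) Y.
Proof.
rewrite /dot exchange_big /=; apply: eq_bigr => k _.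
by rewrite summxE mulr_suml.
Qed.

Lemma dot_scalel n a (X Y : 'cV[R]_n) : dot (a *: X) Y = a * dot X Y.
Proof. by rewrite /dot mulr_sumr; apply: eq_bigr => k _; rewrite mxE mulrA. Qed.

Lemma cV_sum n (X : 'cV[R]_n) : X = \sum_i X i 0 *: basis_vec R i.
Proof.
rewrite {1}[X]matrix_sum_delta; apply: eq_bigr => i _.
by rewrite big_ord_recl big_ord0 addr0.
Qed.

Lemma linear_sum_basis n p (f : 'cV[R]_n -> 'cV[R]_p) (X : 'cV[R]_n) :
  linear f -> f X = \sum_i X i 0 *: f (basis_vec R i).
Proof.
move=> linf.
have f0 : f 0 = 0.
  by have := linf (-1) 0 0; rewrite scaler0 addr0 scaleN1r addNr.
rewrite {1}[X]cV_sum.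
apply: (big_ind2 (fun u v => f u = v)) => [//|u1 v1 u2 v2 <- <-|i _].
  by have := linf 1 u1 u2; rewrite !scale1r.
by have := linf (X i 0) (basis_vec R i) 0; rewrite !addr0 f0 addr0.
Qed.

Lemma JP mu Z X Y : V38 mu -> dot (J mu Z *m X) Y = dot (mu X Y) Z.
Proof.
case=> linl linr _.
rewrite (linear_sum_basis Y (linr X)) dot_suml; apply: eq_bigr => i _.
rewrite (linear_sum_basis X (linl _)) dot_scalel dot_suml mulrC mxE.
congr (_ * _); apply: eq_bigr => j _.
by rewrite dot_scalel mxE mulrC.
Qed.

Definition nonsingular mu : Prop := forall Z, Z != 0 -> J mu Z \in unitmx.

Definition only_eigenvalues_pm_i (B : 'M[R]_8) : Prop :=
  forall z : R[i], eigenvalue (map_mx (real_complex R) B) z ->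
    z = 'i%C \/ z = - 'i%C.

Definition polynomial_on_so8 (f : 'M[R]_8 -> R) : Prop :=
  exists p : mpoly.mpoly (8 * 8) R, forall B, skew_mx B ->
    f B = mpoly.meval (fun k => mxvec B 0 k) p.

(* Only the values of Pf on skew-symmetric matrices are constrained.         *)
Definition pfaffian (J0 : 'M[R]_8) (Pf : 'M[R]_8 -> R) : Prop :=
  [/\ polynomial_on_so8 Pf,
      forall B, skew_mx B -> Pf B ^+ 2 = \det B &
      Pf J0 = 1].

Definition vec3 (x y z : R) : 'cV[R]_3 :=
  x *: basis_vec R 0 + y *: basis_vec R 1 + z *: basis_vec R 2.

Definition pfaffian_form (Pf : 'M[R]_8 -> R) mu (x y z : R) : R :=
  Pf (J mu (vec3 x y z)).

Definition mx_of_rows (m n : nat) (s : seq (seq R)) : 'M[R]_(m, n) :=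
  \matrix_(i, j) (nth [::] s i)`_j.

Definition Jt (t x y z : R) : 'M[R]_8 :=
  let a := (- t - Num.sqrt (t ^+ 2 - 4)) / 2 in
  let b := (- t + Num.sqrt (t ^+ 2 - 4)) / 2 in
  mx_of_rows 8 8
  [:: [::        0;         0;  a * x;      0;   0;   y;   0; z];
      [::        0;         0;      0;  b * x;   y;   0; - z; 0];
      [:: - (a * x);        0;      0;      0;   0;   z;   y; 0];
      [::        0; - (b * x);      0;      0;   z;   0;   0; y];
      [::        0;       - y;      0;    - z;   0;   0;   0; x];
      [::      - y;         0;    - z;      0;   0;   0;   x; 0];
      [::        0;         z;    - y;      0;   0; - x;   0; 0];
      [::      - z;         0;      0;    - y; - x;   0;   0; 0]].

Lemma dot_vec3 (W : 'cV[R]_3) x y z :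
  dot W (vec3 x y z) = x * W 0 0 + y * W 1 0 + z * W 2 0.
Proof.
rewrite /dot !big_ord_recl big_ord0 addr0 !mxE /=.
rewrite !mulr1 !mulr0 !addr0 !add0r addrA !(mulrC (W _ _)).
by congr (_ * W _ _ + _ * W _ _ + _ * W _ _); apply/val_inj.
Qed.

Lemma Jt_V38 t :
  exists mu, V38 mu /\ forall x y z, J mu (vec3 x y z) = Jt t x y z.
Proof.
pose mu (X Y : 'cV[R]_8) : 'cV[R]_3 := \col_k
  (Y^T *m Jt t (k == 0)%:R (k == 1)%:R (k == 2)%:R *m X) 0 0.
have skewJt x y z : (Jt t x y z)^T = - Jt t x y z.
  apply/matrixP => i j; rewrite !mxE.
  case: i j => [i lti] [j ltj] /=.
  do 8 (destruct i as [|i];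
    [do 8 (destruct j as [|j]; [by rewrite /= ?(opprK, oppr0)|]); by []|]).
  by [].
pose K (k : 'I_3) := Jt t (k == 0)%:R (k == 1)%:R (k == 2)%:R.
have muE X Y k : mu X Y k 0 = (Y^T *m K k *m X) 0 0 by rewrite mxE.
have addE n (A B : 'cV[R]_n) k : (A + B) k 0 = A k 0 + B k 0 by rewrite mxE.
have scaleE n c (A : 'cV[R]_n) k : (c *: A) k 0 = c * A k 0 by rewrite mxE.
have oppE n (A : 'cV[R]_n) k : (- A) k 0 = - A k 0 by rewrite mxE.
exists mu; split=> [|x y z].
  split=> [Y a X X'|X a Y Y'|X Y]; apply/matrixP => k l; rewrite (ord1 l).
  - by rewrite addE scaleE !muE mulmxDr -scalemxAr addE scaleE.
  - by rewrite addE scaleE !muE linearP /= !mulmxDl -!scalemxAl addE scaleE.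
  - rewrite oppE !muE -[in RHS](trmxK (X^T *m K k *m Y)) [in RHS]mxE.
    by rewrite !trmx_mul trmxK skewJt mulmxA mulmxN mulNmx oppE opprK.
apply/matrixP => i j; rewrite mxE dot_vec3 !muE.
have eB (B : 'M[R]_8) : ((basis_vec R i)^T *m B *m basis_vec R j) 0 0 = B i j.
  by rewrite /basis_vec trmx_delta -rowE -colE !mxE.
rewrite !eB !mxE /=.
case: i j {eB} => [i lti] [j ltj] /=.
do 8 (destruct i as [|i];
  [do 8 (destruct j as [|j];
     [by rewrite /= ?(mulr0, mulr1, oppr0, mulrN, addr0, add0r) // mulrC|]);
   by []|]).
by [].
Qed.

End V38.

(* Main.v *)
(** Write f_t for the quartic of the statement.

    Pfaffian form.  On the line joining J_0 = J(Z_2) to J(Z), both Pf and f_t are polynomials in one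
    variable; their squares agree, being the determinant, and both are 1 at J_0, so they are equal.

    Non-isomorphism.  An isomorphism is block triangular for n = n_1 + n_2, whence f_s o L = c f_t
    with L invertible and c > 0.  For s <> 6 the polarization of f_s forces L to preserve the
    plane z = 0 and the line x = y = 0, and the invariants I and J of the binary quartics
    x^4 + y^4 + s x^2 y^2 determine s up to the scaling fixed by c and det L.

    Nilsoliton.  In each colour k the matrix J(Z_k) is monomial, so it is a perfect matching on the
    8 basis vectors of n_1.  For a diagonal inner product (g_i), (h_k) give the edge ij of colour k,
    with entry c, the weight c^2 h_k / (g_i g_j).  The Ricci operator is diag(-3/2, 2) as soon as
    the weights sum to 3 at every vertex and to 4 over every colour, and
    diag(-3/2, 2) = -5 + diag(7/2, 7) where diag(7/2, 7) is a derivation. *)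

Require Import Defs.
From mathcomp Require Import all_boot all_order all_algebra.
From mathcomp Require Import reals complex.
From mathcomp Require Import ring lra zify.
From mathcomp Require mpoly.
Set Implicit Arguments.
Unset Strict Implicit.
Unset Printing Implicit Defensive.
Import Order.TTheory GRing.Theory Num.Theory.
Local Open Scope ring_scope.

(** * Determinants of sparse matrices *)

(** Laplace expansion along the first row. [None] marks a structural zero, whose minor is never
    expanded, so on a concrete pattern the determinant unfolds to a short polynomial. *)
Fixpoint sparse_det {R : comPzRingType} (n : nat) (s : seq (seq (option R))) : R :=
  if n is m.+1 then
    foldr (fun j acc =>
      if nth None (head [::] s) j is Some c then
        (let d := c * sparse_det m [seq take j r ++ drop j.+1 r | r <- behead s] in
         if odd j then - d else d) + acc
      else acc) 0 (iota 0 n)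
  else 1.

Definition sparse_mx {R : comPzRingType} (n : nat) (s : seq (seq (option R))) : 'M[R]_n :=
  \matrix_(i, j) odflt 0 (nth None (nth [::] s i) j).

Lemma sparse_detE (R : comPzRingType) n (s : seq (seq (option R))) :
  sparse_det n s = \det (sparse_mx n s).
Proof.
elim: n s => [|n IHn] s; first by rewrite det_mx00.
rewrite (expand_det_row _ ord0).
pose F j := odflt 0 (nth None (head [::] s) j) * ((-1) ^+ j *
  sparse_det n [seq take j r ++ drop j.+1 r | r <- behead s]).
transitivity (\sum_(j < n.+1) F j); last first.
  apply: eq_bigr => j _; rewrite /F /cofactor add0n mxE nth0; congr (_ * (_ * _)).
  rewrite IHn; congr (\det _); apply/matrixP => i k; rewrite !mxE /= /bump leq0n add1n -nth_behead.
  have [lti|gei] := ltnP i (size (behead s)); last first.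
    by rewrite !(nth_default [::]) ?size_map // !nth_nil.
  rewrite (nth_map [::]) //; set r := nth _ _ i.
  congr odflt; rewrite nth_cat size_take.
  have [ltj|gej] := ltnP j (size r).
    by case: ltnP => h; rewrite ?nth_take // nth_drop; congr nth; lia.
  case: ltnP => h; first by rewrite nth_take 1?(leq_trans h) //; congr nth; lia.
  by rewrite !nth_default ?size_drop //; lia.
rewrite -(big_mkord xpredT F) /index_iota subn0.
cbn [sparse_det]; elim: (iota 0 n.+1) => [|j l IHl]; first by rewrite big_nil.
rewrite big_cons -IHl /= /F; case: nth => [c|] /=; last by rewrite mul0r add0r.
by congr (_ + _); rewrite -signr_odd; case: odd; rewrite ?expr1 ?expr0; ring.
Qed.

(** * Determinant and Pfaffian of [Jt] *)

Section JtDet.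
Variable R : realType.

Lemma Jt_sparse (t x y z : R) :
  let a := (- t - Num.sqrt (t ^+ 2 - 4)) / 2 in
  let b := (- t + Num.sqrt (t ^+ 2 - 4)) / 2 in
  Jt t x y z = sparse_mx 8
  [:: [::        None;         None;  Some (a * x);      None;   None;   Some y;   None; Some z];
      [::        None;         None;      None;  Some (b * x);   Some y;   None; Some (- z); None];
      [:: Some (- (a * x));        None;      None;      None;   None;   Some z;   Some y; None];
      [::        None; Some (- (b * x));      None;      None;   Some z;   None;   None; Some y];
      [::        None;       Some (- y);      None;    Some (- z);   None;   None;   None; Some x];
      [::      Some (- y);         None;    Some (- z);      None;   None;   None;   Some x; None];
      [::        None;         Some z;    Some (- y);      None;   None; Some (- x);   None; None];
      [::      Some (- z);         None;      None;    Some (- y); Some (- x);   None;   None; None]].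
Proof.
move=> a b; apply/matrixP => i j; rewrite !mxE.
case: i j => [i lti] [j ltj] /=.
do 8 (destruct i as [|i]; [do 8 (destruct j as [|j]; [by []|]); by []|]).
by [].
Qed.

Lemma det_Jt (t x y z : R) : 2 <= t ->
  \det (Jt t x y z) = (x ^+ 4 + y ^+ 4 + z ^+ 4 + t * x ^+ 2 * y ^+ 2) ^+ 2.
Proof.
move=> t2; rewrite Jt_sparse -sparse_detE.
set a := (- t - _) / 2; set b := (- t + _) / 2.
have sq : Num.sqrt (t ^+ 2 - 4) ^+ 2 = t ^+ 2 - 4 by rewrite sqr_sqrtr //; nra.
have ab : a * b = 1.
  have -> : a * b = (t ^+ 2 - Num.sqrt (t ^+ 2 - 4) ^+ 2) / 4 by rewrite /a /b; field.
  by rewrite sq; field.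
(* With [t] replaced by [- (a + b)] and [a * b] put before [x ^+ 4], the claim is a polynomial
   identity in independent [a] and [b]; the square root is gone. *)
have -> : t = - (a + b) by rewrite /a /b; field.
have -> : x ^+ 4 = (a * b) * x ^+ 4 by rewrite ab mul1r.
clearbody a b.
cbv [sparse_det iota foldr nth head behead map take drop odd cat negb].
ring.
Qed.

Lemma Jt_tr (t x y z : R) : (Jt t x y z)^T = - Jt t x y z.
Proof.
apply/matrixP => i j; rewrite !mxE; case: i j => [i lti] [j ltj] /=.
do 8 (destruct i as [|i];
  [do 8 (destruct j as [|j]; [by rewrite /= ?(opprK, oppr0)|]); by []|]).
by [].
Qed.

Lemma quartic_gt0 (t x y z : R) : 0 <= t -> (x, y, z) != (0, 0, 0) ->
  0 < x ^+ 4 + y ^+ 4 + z ^+ 4 + t * x ^+ 2 * y ^+ 2.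
Proof.
move=> t0 nz.
have e4 (w : R) : w ^+ 4 = (w ^+ 2) ^+ 2 by rewrite -exprM.
have := mulr_ge0 (mulr_ge0 t0 (sqr_ge0 x)) (sqr_ge0 y).
have := sqr_ge0 (x ^+ 2); have := sqr_ge0 (y ^+ 2); have := sqr_ge0 (z ^+ 2).
rewrite -!e4 => hz hy hx hxy.
rewrite lt_neqAle; apply/andP; split; last by lra.
apply: contraNneq nz => f0.
have [x0 y0 z0] : [/\ x ^+ 4 = 0, y ^+ 4 = 0 & z ^+ 4 = 0] by split; lra.
by move: x0 y0 z0 => /eqP; rewrite expf_eq0 /= => /eqP -> /eqP;
  rewrite expf_eq0 /= => /eqP -> /eqP; rewrite expf_eq0 /= => /eqP ->.
Qed.

Lemma vec3E (Z : 'cV[R]_3) : Z = vec3 (Z 0 0) (Z 1 0) (Z 2 0).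
Proof.
apply/matrixP => i j; rewrite (ord1 j) !mxE; case: i => [[|[|[|//]]] lti] /=;
  rewrite !(mulr0, mulr1, addr0, add0r); congr (Z _ _); exact/val_inj.
Qed.

Lemma vec3_eq0 (x y z : R) : (vec3 x y z == 0) = ((x, y, z) == (0, 0, 0)).
Proof.
apply/eqP/eqP => [|[-> -> ->]]; last by rewrite /vec3 !scale0r !addr0.
move/matrixP=> h; have := h 0 0; have := h 1 0; have := h 2 0.
by rewrite !mxE /= !(mulr0, mulr1, addr0, add0r) => -> -> ->.
Qed.

Lemma Jt_010_sq (t : R) : Jt t 0 1 0 *m Jt t 0 1 0 = - 1%:M.
Proof.
apply/matrixP => i j; rewrite !mxE !big_ord_recl big_ord0 !mxE.
case: i j => [i lti] [j ltj] /=.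
do 8 (destruct i as [|i]; [do 8 (destruct j as [|j]; [by rewrite /=; ring|]); by []|]).
by [].
Qed.

(** At x = 0 the entries a and b disappear, so a single J_0 normalizes the Pfaffian for the whole
    family. *)
Lemma Jt_010 (s t : R) : Jt s 0 1 0 = Jt t 0 1 0.
Proof. by rewrite /Jt !mulr0. Qed.

Lemma only_eigenvalues_of_sq (B : 'M[R]_8) : B *m B = - 1%:M -> only_eigenvalues_pm_i B.
Proof.
move=> BB z /eigenvalueP[v vB v0].
have : v *m map_mx (real_complex R) B *m map_mx (real_complex R) B = - v.
  by rewrite -mulmxA -map_mxM BB map_mxN map_mx1 mulmxN mulmx1.
rewrite vB -scalemxAl vB scalerA => h.
have : (z * z + 1) *: v = 0 by rewrite scalerDl h scale1r addNr.
move/eqP; rewrite scaler_eq0 (negPf v0) orbF => /eqP zz.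
have : (z - 'i%C) * (z + 'i%C) = 0.
  have ii : 'i%C * 'i%C = -1 :> R[i] by rewrite -expr2 sqr_i.
  by rewrite -zz mulrDr !mulrBl ii; ring.
move/eqP; rewrite mulf_eq0 subr_eq0 addr_eq0 => /orP[] /eqP ->; first by left.
by right.
Qed.

Lemma poly_eqP_field (p q : {poly R}) : (forall r, p.[r] = q.[r]) -> p = q.
Proof.
move=> h; apply/eqP; rewrite -subr_eq0; apply/negPn/negP => nz.
(* The naturals below [size (p - q)] are distinct in characteristic 0 and give one root more than
   the degree allows. *)
pose s := [seq i%:R : R | i <- iota 0 (size (p - q))].
have := @max_poly_roots _ _ s nz; rewrite size_map size_iota ltnn => /(_ _ _)/wrap[]//.
  by apply/allP => _ /mapP[i _ ->]; rewrite /root hornerD hornerN h subrr.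
by rewrite map_inj_uniq ?iota_uniq // => i j /eqP; rewrite eqr_nat => /eqP.
Qed.

(** Restriction to a line moves the comparison of Pf with the quartic into [{poly R}], an integral
    domain, where a square determines its root up to one global sign. *)
Lemma meval_line n (p : mpoly.mpoly n R) (u v : 'I_n -> R) :
  exists q : {poly R}, forall r, q.[r] = mpoly.meval (fun k => u k + r * v k) p.
Proof.
exists (\sum_(m <- mpoly.msupp p) (mpoly.mcoeff m p)%:P *
  \prod_i ((u i)%:P + 'X * (v i)%:P) ^+ mpoly.fun_of_multinom m i) => r.
rewrite mpoly.mevalE horner_sum; apply: eq_bigr => m _.
rewrite hornerM hornerC horner_prod; congr (_ * _); apply: eq_bigr => i _.
by rewrite horner_exp hornerD hornerM hornerX !hornerC.
Qed.

Lemma pfaffian_Jt (Pf : 'M[R]_8 -> R) (t x y z : R) : 2 <= t ->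
  pfaffian (Jt t 0 1 0) Pf ->
  Pf (Jt t x y z) = x ^+ 4 + y ^+ 4 + z ^+ 4 + t * x ^+ 2 * y ^+ 2.
Proof.
move=> t2 [[p pE] sq Pf1].
(* [B 0] is the normalizing matrix and [B 1] the given one; [B] is affine in [r] because [Jt] is
   linear in x, y, z. *)
pose B r := Jt t (r * x) (1 + r * (y - 1)) (r * z).
have [q qE] := meval_line p (fun k => mxvec (B 0) 0 k) (fun k => mxvec (B 1 - B 0) 0 k).
have {}qE r : q.[r] = Pf (B r).
  rewrite qE pE; last exact: Jt_tr.
  apply: mpoly.meval_eq => k; rewrite -[X in _ + r * X]/(mxvec _ 0 k).
  have -> : B r = B 0 + r *: (B 1 - B 0).
    apply/matrixP => i j; rewrite !mxE; case: i j => [i lti] [j ltj] /=.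
    do 8 (destruct i as [|i]; [do 8 (destruct j as [|j]; [by rewrite /=; ring|]); by []|]).
    by [].
  by move: (B 1 - B 0) => C; rewrite (linearD mxvec) mxE (linearZ_LR mxvec) mxE.
pose F := (x%:P * 'X) ^+ 4 + (1%:P + (y - 1)%:P * 'X) ^+ 4 + (z%:P * 'X) ^+ 4 +
   t%:P * (x%:P * 'X) ^+ 2 * (1%:P + (y - 1)%:P * 'X) ^+ 2 : {poly R}.
have FE r : F.[r] = (r * x) ^+ 4 + (1 + r * (y - 1)) ^+ 4 + (r * z) ^+ 4 +
   t * (r * x) ^+ 2 * (1 + r * (y - 1)) ^+ 2.
  by rewrite /F !(hornerD, hornerM, horner_exp, hornerX, hornerC); ring.
have qF : q ^+ 2 = F ^+ 2.
  apply: poly_eqP_field => r; rewrite !horner_exp FE qE sq ?det_Jt //; exact: Jt_tr.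
have q0 : q.[0] = 1 by rewrite qE /B !mul0r addr0.
have F0 : F.[0] = 1 by rewrite FE; ring.
have {}qF : q = F.
  (* The sign is the same along the whole line, and the value 1 at 0 excludes [- F]. *)
  move/eqP: qF; rewrite eqf_sqr => /orP[] /eqP // qNF.
  by move: q0; rewrite qNF hornerN F0 => h; exfalso; lra.
by have := qE 1; rewrite qF FE /B !mul1r subrKC.
Qed.
End JtDet.

(** * Isomorphism invariants: from brackets to quartics *)

Section Isomorphism.
Variable R : realType.

Lemma dotE n (X Y : 'cV[R]_n) : dot X Y = (Y^T *m X) 0 0.
Proof. by rewrite mxE; apply: eq_bigr => i _; rewrite mxE mulrC. Qed.

(** The hypothesis says that the values of [mu] span n_2, so n_2 is the derived algebra and [phi]
    cannot send it outside n_2: the rows of the block [B] are orthogonal to every [mu X Y]. *)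
Lemma lie_isomorphic_blocks (mu mu' : 'cV[R]_8 -> 'cV[R]_8 -> 'cV[R]_3) :
  (forall Z, (forall X Y, dot (mu X Y) Z = 0) -> Z = 0) ->
  lie_isomorphic (bracket mu) (bracket mu') ->
  exists A : 'M[R]_8, exists D : 'M[R]_3,
    [/\ A \in unitmx, D \in unitmx &
      forall X Y, D *m mu X Y = mu' (A *m X) (A *m Y)].
Proof.
move=> span [phi [phiU phiB]].
pose A := ulsubmx phi; pose B := ursubmx phi.
pose C := dlsubmx phi; pose D := drsubmx phi.
have phiE : phi = block_mx A B C D by rewrite submxK.
have h X Y : B *m mu X Y = 0 /\ D *m mu X Y = mu' (A *m X) (A *m Y).
  have := phiB (col_mx X 0) (col_mx Y 0).
  rewrite phiE /bracket !mul_block_col !mulmx0 !addr0 !col_mxKu add0r.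
  by rewrite ?mulmx0 ?add0r => /eq_col_mx[].
have B0 : B = 0.
  apply/row_matrixP => i; rewrite row0; apply: trmx_inj; rewrite trmx0.
  apply: span => X Y; rewrite dotE trmxK -row_mul.
  by have [-> _] := h X Y; rewrite row0 mxE.
exists A, D; move: phiU; rewrite phiE B0 !unitmxE det_lblock unitrM => /andP[uA uD].
by split=> // X Y; have [] := h X Y.
Qed.

(** [J] is dual to the bracket, so [D] crosses the inner product as its transpose. *)
Lemma J_congruence (mu mu' : 'cV[R]_8 -> 'cV[R]_8 -> 'cV[R]_3) (A : 'M[R]_8) (D : 'M[R]_3) Z :
  V38 mu -> V38 mu' -> (forall X Y, D *m mu X Y = mu' (A *m X) (A *m Y)) ->
  J mu (D^T *m Z) = A^T *m J mu' Z *m A.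
Proof.
move=> muV muV' h; apply/matrixP => i j; rewrite mxE.
have -> : dot (mu (basis_vec R j) (basis_vec R i)) (D^T *m Z) =
    dot (D *m mu (basis_vec R j) (basis_vec R i)) Z.
  by rewrite !dotE trmx_mul trmxK mulmxA.
rewrite h -JP // dotE trmx_mul !mulmxA -(mulmxA _ _ (basis_vec R j)) -!mulmxA.
by rewrite /basis_vec trmx_delta -rowE mxE !mulmxA -colE mxE -!mulmxA.
Qed.

Definition quartic (t : R) (v : 'cV[R]_3) : R :=
  v 0 0 ^+ 4 + v 1 0 ^+ 4 + v 2 0 ^+ 4 + t * v 0 0 ^+ 2 * v 1 0 ^+ 2.

Lemma det_J (mu : 'cV[R]_8 -> 'cV[R]_8 -> 'cV[R]_3) t :
  2 <= t -> (forall x y z : R, J mu (vec3 x y z) = Jt t x y z) ->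
  forall Z, \det (J mu Z) = quartic t Z ^+ 2.
Proof. by move=> t2 muJ Z; rewrite {1}[Z]vec3E muJ det_Jt. Qed.

Lemma quartic_pos t (v : 'cV[R]_3) : 2 <= t -> v != 0 -> 0 < quartic t v.
Proof.
move=> t2 v0; apply: quartic_gt0; first by lra.
by rewrite -vec3_eq0 -vec3E.
Qed.

Lemma nonsingular_Jt (mu : 'cV[R]_8 -> 'cV[R]_8 -> 'cV[R]_3) t :
  2 <= t -> (forall x y z : R, J mu (vec3 x y z) = Jt t x y z) -> nonsingular mu.
Proof.
move=> t2 muJ Z Z0; rewrite unitmxE (det_J t2 muJ) unitfE.
by rewrite expf_neq0 // gt_eqF // quartic_pos.
Qed.

Lemma isomorphic_quartics (mu mu' : 'cV[R]_8 -> 'cV[R]_8 -> 'cV[R]_3) s t :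
  2 <= s -> 2 <= t -> V38 mu -> V38 mu' ->
  (forall x y z : R, J mu (vec3 x y z) = Jt s x y z) ->
  (forall x y z : R, J mu' (vec3 x y z) = Jt t x y z) ->
  lie_isomorphic (bracket mu) (bracket mu') ->
  exists c : R, exists L : 'M[R]_3,
    [/\ 0 < c, L \in unitmx & forall v, quartic s (L *m v) = c * quartic t v].
Proof.
move=> s2 t2 muV muV' muJ muJ' iso.
have span Z : (forall X Y, dot (mu X Y) Z = 0) -> Z = 0.
  move=> hZ; apply/eqP/negPn/negP => Z0.
  have J0 : J mu Z = 0 by apply/matrixP => i j; rewrite !mxE hZ.
  by have := nonsingular_Jt s2 muJ Z0; rewrite J0 unitmxE det0 unitr0.
have [A [D [uA uD h]]] := lie_isomorphic_blocks span iso.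
have A0 : \det A != 0 by rewrite -unitfE -unitmxE.
(* Determinants of the congruence relate the squares of the quartics by the factor [\det A ^+ 2];
   both quartics are nonnegative, so square roots may be taken. *)
exists `|\det A|, D^T; split; rewrite ?normr_gt0 ?unitmx_tr // => v.
have [->|v0] := eqVneq v 0.
  by rewrite mulmx0 /quartic !mxE; ring.
have uDT : D^T \in unitmx by rewrite unitmx_tr.
have Lv0 : D^T *m v != 0.
  by apply: contraNneq v0 => e; rewrite -(mulKmx uDT v) e mulmx0.
have := det_J s2 muJ (D^T *m v).
rewrite (J_congruence _ muV muV' h) !det_mulmx det_tr (det_J t2 muJ').
move=> e; apply/eqP; rewrite -(eqrXn2 (n := 2)) //.
- rewrite -e exprMn real_normK ?num_real //; apply/eqP; ring.
- exact/ltW/quartic_pos.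
- by rewrite mulr_ge0 // ltW // quartic_pos.
Qed.

(** Inclusion-exclusion over the nonempty subsets of the arguments; on a quartic form it gives 4!
    times the symmetric 4-linear form. *)
Definition polarization (f : 'cV[R]_3 -> R) (a b c d : 'cV[R]_3) : R :=
  f (a + b + c + d) - f (a + b + c) - f (a + b + d) - f (a + c + d) - f (b + c + d)
  + f (a + b) + f (a + c) + f (a + d) + f (b + c) + f (b + d) + f (c + d)
  - f a - f b - f c - f d.

(** The coefficient [t] is shared among the 6 placements of two x-slots and two y-slots. *)
Definition quartic_form (t : R) (a b c d : 'cV[R]_3) : R :=
  a 0 0 * b 0 0 * c 0 0 * d 0 0 + a 1 0 * b 1 0 * c 1 0 * d 1 0
  + a 2 0 * b 2 0 * c 2 0 * d 2 0 + t / 6 *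
  (a 0 0 * b 0 0 * c 1 0 * d 1 0 + a 0 0 * b 1 0 * c 0 0 * d 1 0
   + a 0 0 * b 1 0 * c 1 0 * d 0 0 + a 1 0 * b 0 0 * c 0 0 * d 1 0
   + a 1 0 * b 0 0 * c 1 0 * d 0 0 + a 1 0 * b 1 0 * c 0 0 * d 0 0).

Lemma polarization_quartic t a b c d :
  polarization (quartic t) a b c d = 24 * quartic_form t a b c d.
Proof. by rewrite /polarization /quartic /quartic_form !mxE; field. Qed.

Lemma quartic_form_mul s t k (L : 'M[R]_3) :
  (forall v, quartic s (L *m v) = k * quartic t v) ->
  forall a b c d, quartic_form s (L *m a) (L *m b) (L *m c) (L *m d) = k * quartic_form t a b c d.
Proof.
move=> h a b c d; apply: (mulfI (x := 24)); first by rewrite pnatr_eq0.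
rewrite -polarization_quartic mulrCA -polarization_quartic /polarization.
by rewrite -!mulmxDr !h; ring.
Qed.

(* The resolvent cubic of [x^4 + 6 u x^2 y^2 + y^4] has the roots [2 u], [1 - u], [-1 - u];
   for [u >= 1/3] the largest is [2 u]. *)
Lemma binary_quartic_invariants (u v d : R) : 1 / 3 <= u -> 1 / 3 <= v -> 0 < d ->
  d ^+ 2 * (1 + 3 * u ^+ 2) = 1 + 3 * v ^+ 2 -> d ^+ 3 * (u - u ^+ 3) = v - v ^+ 3 -> u = v.
Proof.
move=> u3 v3 d0 eI eJ.
(* Both sides have the form X^3 - I X + 2 J with equal I and J, so the roots agree and the largest
   ones can be compared. *)
have cubic X : (X - 2 * (d * u)) * (X - d * (1 - u)) * (X + d * (1 + u)) =
    (X - 2 * v) * (X - (1 - v)) * (X + (1 + v)).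
  transitivity (X ^+ 3 - d ^+ 2 * (1 + 3 * u ^+ 2) * X + 2 * (d ^+ 3 * (u - u ^+ 3))); first by ring.
  by rewrite eI eJ; ring.
have le1 : 2 * v <= 2 * (d * u).
  have /eqP := cubic (2 * v); rewrite subrr !mul0r !mulf_eq0 => /orP[/orP[]|] /eqP h.
  - by lra.
  - suff : d * (1 - u) <= 2 * (d * u) by lra.
    by nra.
  - suff : 0 < d * (1 + u) by lra.
    by apply: mulr_gt0; lra.
have le2 : 2 * (d * u) <= 2 * v.
  have /esym/eqP := cubic (2 * (d * u)); rewrite subrr !mul0r !mulf_eq0 => /orP[/orP[]|] /eqP h; lra.
(* Once [v = d * u], the equation [eI] reduces to [d ^+ 2 = 1]. *)
have e : v = d * u by lra.
have d1 : d ^+ 2 = 1 by move: eI; rewrite e exprMn; lra.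
have {}d1 : d = 1 by apply/eqP; rewrite -(eqrXn2 (n := 2)) ?ltW // d1 expr1n.
by rewrite e d1 mul1r.
Qed.

Lemma quartic_rigid_neq6 s t k (L : 'M[R]_3) :
  2 <= s -> 2 <= t -> s != 6 -> 0 < k -> L \in unitmx ->
  (forall v, quartic s (L *m v) = k * quartic t v) -> s = t.
Proof.
move=> s2 t2 s6 k0 uL /quartic_form_mul h.
pose e (i : 'I_3) := basis_vec R i.
have Linj a : L *m a = 0 -> a = 0.
  by move=> a0; rewrite -(mulKmx uL a) a0 mulmx0.
have eE (i j : 'I_3) : e i j 0 = (j == i)%:R by rewrite mxE andbT.
have [p pE] : {p | p = L *m e 0} by exists (L *m e 0).
have [q qE] : {q | q = L *m e 1} by exists (L *m e 1).
have [w wE] : {w | w = L *m e 2} by exists (L *m e 2).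
(* For f_t, filling two slots with [e 2] and [e 0], or with [e 2] and [e 1], gives zero whatever
   fills the others; as [L] is onto, this transports to all [a] and [b]. *)
have wp a b : quartic_form s w p a b = 0.
  rewrite wE ?pE ?qE -(mulKVmx uL a) -(mulKVmx uL b) h /quartic_form !eE /=.
  by ring.
have wq a b : quartic_form s w q a b = 0.
  rewrite wE ?pE ?qE -(mulKVmx uL a) -(mulKVmx uL b) h /quartic_form !eE /=.
  by ring.
pose u := s / 6.
(* Here s = 6 must be excluded: f_6 = ((x + y)^4 + (x - y)^4) / 2 + z^4 is a sum of three fourth
   powers, and the z-axis is no longer distinguished. *)
have u1 : 1 - u ^+ 2 != 0.
  rewrite subr_eq0 eq_sym sqrf_eq1 negb_or; apply/andP; split.
    by apply: contra s6 => /eqP; rewrite /u => hu; apply/eqP; lra.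
  by apply/eqP; rewrite /u; lra.
(* The choices ([e 0], [e 0]) and ([e 1], [e 1]) give a linear system in [w 0 0 * r 0 0] and
   [w 1 0 * r 1 0] of determinant [1 - u ^+ 2]. *)
have key (r : 'cV[R]_3) : (forall a b, quartic_form s w r a b = 0) ->
    [/\ w 0 0 * r 0 0 = 0, w 1 0 * r 1 0 = 0, w 2 0 * r 2 0 = 0 & w 0 0 * r 1 0 + w 1 0 * r 0 0 = 0].
  move=> hr.
  have h00 := hr (e 0) (e 0); have h11 := hr (e 1) (e 1).
  have h22 := hr (e 2) (e 2); have h01 := hr (e 0) (e 1).
  move: h00 h11 h22 h01; rewrite /quartic_form !eE /= -/u !(mulr0, mulr1, addr0, add0r).
  move=> h00 h11 h22 h01.
  have z1 : (1 - u ^+ 2) * (w 0 0 * r 0 0) = 0 by move/(congr1 ( *%R u)): h11; rewrite mulr0; lra.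
  have z2 : (1 - u ^+ 2) * (w 1 0 * r 1 0) = 0 by move/(congr1 ( *%R u)): h00; rewrite mulr0; lra.
  split=> //.
  - by move/eqP: z1; rewrite mulf_eq0 (negPf u1) => /eqP.
  - by move/eqP: z2; rewrite mulf_eq0 (negPf u1) => /eqP.
  - move/eqP: h01; rewrite mulf_eq0 => /orP[|/eqP //].
    by move=> /eqP; rewrite /u => hu; exfalso; lra.
have ext (a b : 'cV[R]_3) : a 0 0 = b 0 0 -> a 1 0 = b 1 0 -> a 2 0 = b 2 0 -> a = b.
  by move=> a0 a1 a2; rewrite [a]vec3E [b]vec3E a0 a1 a2.
have e_neq0 i : e i != 0.
  by apply/eqP => /matrixP/(_ i 0); rewrite eE eqxx mxE; apply/eqP; rewrite oner_eq0.
have [[wp0 wp1 wp2 wp3] [wq0 wq1 wq2 wq3]] := (key p wp, key q wq).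
(* The independent vectors [p] and [q] cannot both lie on the z-axis; by [key] they would if [w]
   left it. *)
have nz : ~ [/\ p 0 0 = 0, p 1 0 = 0, q 0 0 = 0 & q 1 0 = 0].
  case=> p0 p1 q0 q1.
  have : L *m (q 2 0 *: e 0 - p 2 0 *: e 1) = 0.
    rewrite mulmxBr -!scalemxAr -pE -qE.
    by apply: ext; rewrite !mxE ?p0 ?p1 ?q0 ?q1; ring.
  move/Linj/matrixP => hz; have := hz 1 0.
  rewrite !mxE /= !(mulr0, mulr1, add0r, sub0r) => /eqP; rewrite oppr_eq0 => /eqP p2.
  by have /eqP := e_neq0 0; apply; apply: Linj; apply: ext; rewrite -pE ?p0 ?p1 ?p2 mxE.
have w0 : w 0 0 = 0.
  apply/eqP/negPn/negP => wn; apply: nz.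
  move/eqP: wp0; rewrite mulf_eq0 (negPf wn) => /eqP p0.
  move/eqP: wq0; rewrite mulf_eq0 (negPf wn) => /eqP q0.
  move/eqP: wp3; rewrite p0 mulr0 addr0 mulf_eq0 (negPf wn) => /eqP p1.
  by move/eqP: wq3; rewrite q0 mulr0 addr0 mulf_eq0 (negPf wn) => /eqP q1.
have w1 : w 1 0 = 0.
  apply/eqP/negPn/negP => wn; apply: nz.
  move/eqP: wp1; rewrite mulf_eq0 (negPf wn) => /eqP p1.
  move/eqP: wq1; rewrite mulf_eq0 (negPf wn) => /eqP q1.
  move/eqP: wp3; rewrite p1 mulr0 add0r mulf_eq0 (negPf wn) => /eqP p0.
  by move/eqP: wq3; rewrite q1 mulr0 add0r mulf_eq0 (negPf wn) => /eqP q0.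
have w2 : w 2 0 != 0.
  apply/eqP => w2; have /eqP := e_neq0 2; apply; apply: Linj.
  by apply: ext; rewrite -wE ?w0 ?w1 ?w2 mxE.
have p2 : p 2 0 = 0 by move/eqP: wp2; rewrite mulf_eq0 (negPf w2) => /eqP.
have q2 : q 2 0 = 0 by move/eqP: wq2; rewrite mulf_eq0 (negPf w2) => /eqP.
pose v := t / 6.
(* [L] now preserves the plane z = 0; these five values are the coefficients of the restricted
   binary quartic, equal to k times 1, 0, v, 0, 1. *)
have := h (e 0) (e 0) (e 0) (e 0); have := h (e 0) (e 0) (e 0) (e 1).
have := h (e 0) (e 0) (e 1) (e 1); have := h (e 0) (e 1) (e 1) (e 1).
have := h (e 1) (e 1) (e 1) (e 1).
rewrite -pE -qE /quartic_form p2 q2 !eE /= -/u -/v.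
move: (p 0 0) (p 1 0) (q 0 0) (q 1 0) => {wp0 wp1 wp2 wp3 wq0 wq1 wq2 wq3 nz} a b a' b'.
rewrite !(mulr0, mulr1, mul0r, addr0, add0r) => h4 h3 h2 h1 h0.
pose D := (a * b' - b * a') ^+ 2.
pose Q (x y z w : R * R) := x.1 * y.1 * z.1 * w.1 + x.2 * y.2 * z.2 * w.2 + u *
  (x.1 * y.1 * z.2 * w.2 + x.1 * y.2 * z.1 * w.2 + x.1 * y.2 * z.2 * w.1
   + x.2 * y.1 * z.1 * w.2 + x.2 * y.1 * z.2 * w.1 + x.2 * y.2 * z.1 * w.1).
(* The classical invariants I and J of a binary quartic, which scale by the 4th and 6th powers of
   the determinant of the substitution. *)
have inv (m n : R * R) a0 a1 a2 a3 a4 : Q m m m m = a0 -> Q m m m n = a1 ->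
    Q m m n n = a2 -> Q m n n n = a3 -> Q n n n n = a4 ->
  ((m.1 * n.2 - m.2 * n.1) ^+ 2) ^+ 2 * (1 + 3 * u ^+ 2) = a0 * a4 - 4 * a1 * a3 + 3 * a2 ^+ 2 /\
  ((m.1 * n.2 - m.2 * n.1) ^+ 2) ^+ 3 * (u - u ^+ 3) =
    a0 * a2 * a4 + 2 * a1 * a2 * a3 - a2 ^+ 3 - a0 * a3 ^+ 2 - a1 ^+ 2 * a4.
  by move=> <- <- <- <- <-; rewrite /Q; split; ring.
have [eI eJ] : D ^+ 2 * (1 + 3 * u ^+ 2) = k ^+ 2 * (1 + 3 * v ^+ 2) /\
    D ^+ 3 * (u - u ^+ 3) = k ^+ 3 * (v - v ^+ 3).
  have [] := inv (a, b) (a', b') _ _ _ _ _ h0 h1 h2 h3 h4.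
  by rewrite -/D => -> ->; split; ring.
have D0 : 0 < D.
  rewrite lt_neqAle sqr_ge0 andbT eq_sym; apply/eqP => D0.
  move: eI; rewrite D0 expr0n mul0r => /esym/eqP; rewrite mulf_eq0 expf_eq0 /= gt_eqF //=.
  by move/eqP; have := sqr_ge0 v; lra.
have k1 : k != 0 by rewrite gt_eqF.
suff : u = v by rewrite /u /v => uv; lra.
(* I and J have degrees 2 and 3 in the coefficients, so the factor [k] is absorbed in [D / k]. *)
apply: (@binary_quartic_invariants u v (D / k)); rewrite ?divr_gt0 //.
- by rewrite /u; lra.
- by rewrite /v; lra.
- by rewrite expr_div_n mulrAC eI mulrAC divff ?mul1r ?expf_neq0.
- by rewrite expr_div_n mulrAC eJ mulrAC divff ?mul1r ?expf_neq0.
Qed.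

(** If s = 6 and t <> 6, the roles are exchanged by inverting [L]. *)
Lemma quartic_rigid s t k (L : 'M[R]_3) :
  2 <= s -> 2 <= t -> 0 < k -> L \in unitmx ->
  (forall v, quartic s (L *m v) = k * quartic t v) -> s = t.
Proof.
move=> s2 t2 k0 uL h.
have [s6|s6] := eqVneq s 6; last exact: quartic_rigid_neq6 h.
have [->//|t6] := eqVneq t 6.
apply/esym; apply: (@quartic_rigid_neq6 t s k^-1 (invmx L)) => //.
- by rewrite invr_gt0.
- by rewrite unitmx_inv.
- by move=> v; rewrite -{2}(mulKVmx uL v) h mulKf ?gt_eqF.
Qed.
End Isomorphism.

(** * Connection, curvature and Ricci operator of a diagonal inner product *)

Section Nilsoliton.
Variables (R : realType) (mu : 'cV[R]_8 -> 'cV[R]_8 -> 'cV[R]_3).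
Hypothesis muV : V38 mu.
Variables (g : 'rV[R]_8) (h : 'rV[R]_3).
Hypotheses (g_gt0 : forall i, 0 < g 0 i) (h_gt0 : forall k, 0 < h 0 k).

Let K (k : 'I_3) : 'M[R]_8 := J mu (basis_vec R k).
Let G := diag_mx g.
Let Gi := diag_mx (map_mx GRing.inv g).
Let H := diag_mx h.

Definition diag_ip (U V : 'cV[R]_(8 + 3)) : R :=
  dot (G *m usubmx U) (usubmx V) + dot (H *m dsubmx U) (dsubmx V).

Lemma dot_basis n (X : 'cV[R]_n) k : dot X (basis_vec R k) = X k 0.
Proof.
rewrite /dot (bigD1 k) //= big1 => [|l lk]; last by rewrite mxE (negPf lk) mulr0.
by rewrite mxE !eqxx mulr1 addr0.
Qed.

Lemma J_lincomb (W : 'cV[R]_3) : J mu W = \sum_k W k 0 *: K k.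
Proof.
apply/matrixP => i j; rewrite !mxE summxE /dot; apply: eq_bigr => k _.
by rewrite !mxE dot_basis mulrC.
Qed.

Lemma J_skew W : (J mu W)^T = - J mu W.
Proof.
have [_ _ skew] := muV.
apply/matrixP => i j; rewrite !mxE skew /dot -sumrN; apply: eq_bigr => k _.
by rewrite mxE mulNr.
Qed.

Lemma mu_coord X Y k : mu X Y k 0 = (Y^T *m K k *m X) 0 0.
Proof.
rewrite -[LHS]dot_basis -(JP _ _ _ muV) /dot -mulmxA [RHS]mxE.
by apply: eq_bigr => i _; rewrite [Y^T _ _]mxE mulrC.
Qed.

Lemma muZDl a X X' Y : mu (a *: X + X') Y = a *: mu X Y + mu X' Y.
Proof. by case: muV => + _ _; apply. Qed.

Lemma muZDr a X Y Y' : mu X (a *: Y + Y') = a *: mu X Y + mu X Y'.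
Proof. by case: muV => _ + _; apply. Qed.

Lemma mu0l Y : mu 0 Y = 0.
Proof. by have := muZDl (-1) 0 0 Y; rewrite scaler0 addr0 scaleN1r addNr. Qed.

Lemma mu0r X : mu X 0 = 0.
Proof. by have := muZDr (-1) X 0 0; rewrite scaler0 addr0 scaleN1r addNr. Qed.

Lemma muZl a X Y : mu (a *: X) Y = a *: mu X Y.
Proof. by rewrite -[a *: X]addr0 muZDl mu0l addr0. Qed.

Lemma muZr a X Y : mu X (a *: Y) = a *: mu X Y.
Proof. by rewrite -[a *: Y]addr0 muZDr mu0r addr0. Qed.

(** The J-operator of the bracket relative to [diag_ip] instead of the standard inner product;
    [dot_jmap] is its defining property. *)
Definition jmap (Z : 'cV[R]_3) : 'M[R]_8 := Gi *m J mu (H *m Z).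

Lemma jmapZD a Z Z' : jmap (a *: Z + Z') = a *: jmap Z + jmap Z'.
Proof.
rewrite /jmap scalemxAr -mulmxDr; congr (_ *m _).
apply/matrixP => i j; rewrite mulmxDr -scalemxAr !mxE /dot mulr_sumr -big_split.
by apply: eq_bigr => k _ /=; rewrite !mul_diag_mx !mxE; ring.
Qed.

Lemma jmap0 : jmap 0 = 0.
Proof. by have := jmapZD (-1) 0 0; rewrite scaler0 addr0 scaleN1r addNr. Qed.

Lemma jmapZ a Z : jmap (a *: Z) = a *: jmap Z.
Proof. by rewrite -[a *: Z]addr0 jmapZD jmap0 addr0. Qed.

Lemma jmapE Z : jmap Z = \sum_k (h 0 k * Z k 0) *: (Gi *m K k).
Proof.
rewrite /jmap J_lincomb mulmx_sumr; apply: eq_bigr => k _.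
by rewrite -scalemxAr mul_diag_mx mxE.
Qed.

(** Koszul's formula in the 2-step case: the derivative of Y along X is [X, Y] / 2, the mixed ones
    are - j(Z) X / 2, and those within n_2 vanish. *)
Definition diag_nabla (U V : 'cV[R]_(8 + 3)) : 'cV[R]_(8 + 3) :=
  col_mx (- (1 / 2) *: (jmap (dsubmx V) *m usubmx U + jmap (dsubmx U) *m usubmx V))
         ((1 / 2) *: mu (usubmx U) (usubmx V)).

Lemma diag_nablaE (A X : 'cV[R]_8) (C Z : 'cV[R]_3) :
  diag_nabla (col_mx A C) (col_mx X Z) =
  col_mx (- (1 / 2) *: (jmap Z *m A + jmap C *m X)) ((1 / 2) *: mu A X).
Proof. by rewrite /diag_nabla !col_mxKu !col_mxKd. Qed.

Lemma dotC n (X Y : 'cV[R]_n) : dot X Y = dot Y X.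
Proof. by apply: eq_bigr => i _; rewrite mulrC. Qed.

Lemma dotZD n a (X X' Y : 'cV[R]_n) : dot (a *: X + X') Y = a * dot X Y + dot X' Y.
Proof. by rewrite /dot mulr_sumr -big_split; apply: eq_bigr => i _ /=; rewrite !mxE; ring. Qed.

Lemma dotZDr n a (X Y Y' : 'cV[R]_n) : dot X (a *: Y + Y') = a * dot X Y + dot X Y'.
Proof. by rewrite !(dotC X) dotZD. Qed.

Lemma dotD n (X X' Y : 'cV[R]_n) : dot (X + X') Y = dot X Y + dot X' Y.
Proof. by rewrite -[X]scale1r dotZD scale1r mul1r. Qed.

Lemma dot_diag n (d : 'rV[R]_n) (X Y : 'cV[R]_n) :
  dot (diag_mx d *m X) Y = \sum_i d 0 i * X i 0 * Y i 0.
Proof. by apply: eq_bigr => i _; rewrite mul_diag_mx mxE. Qed.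

Lemma dot_diagC n (d : 'rV[R]_n) (X Y : 'cV[R]_n) : dot (diag_mx d *m X) Y = dot X (diag_mx d *m Y).
Proof. by rewrite (dotC X) !dot_diag; apply: eq_bigr => i _; ring. Qed.

Lemma dot_diag_ge0 n (d : 'rV[R]_n) (X : 'cV[R]_n) : (forall i, 0 < d 0 i) -> 0 <= dot (diag_mx d *m X) X.
Proof.
by move=> d0; rewrite dot_diag sumr_ge0 // => i _; rewrite -mulrA mulr_ge0 ?(ltW (d0 i)) // -expr2 sqr_ge0.
Qed.

Lemma dot_diag_eq0 n (d : 'rV[R]_n) (X : 'cV[R]_n) : (forall i, 0 < d 0 i) ->
  dot (diag_mx d *m X) X = 0 -> X = 0.
Proof.
move=> d0 /eqP; rewrite dot_diag psumr_eq0 => [/allP X0|i _]; last first.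
  by rewrite -mulrA mulr_ge0 ?(ltW (d0 i)) // -expr2 sqr_ge0.
apply/matrixP => i j; rewrite (ord1 j) mxE; apply/eqP.
by have := X0 i (mem_index_enum _); rewrite -mulrA mulf_eq0 gt_eqF //= mulf_eq0 orbb.
Qed.

Lemma diag_ip_inner : inner_product diag_ip.
Proof.
split=> [U a V W|U V|U U0].
- by rewrite /diag_ip !linearP /= !dotZDr; ring.
- by congr (_ + _); rewrite dot_diagC dotC.
- rewrite /diag_ip lt_neqAle addr_ge0 ?dot_diag_ge0 // andbT eq_sym.
  apply: contra U0; rewrite paddr_eq0 ?dot_diag_ge0 // => /andP[/eqP u0 /eqP d0].
  rewrite -[U]vsubmxK (dot_diag_eq0 _ u0) // (dot_diag_eq0 _ d0) //.
  by rewrite col_mx0.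
Qed.

Lemma GGi : G *m Gi = 1%:M.
Proof.
rewrite /G /Gi mulmx_diag; apply/matrixP => i j; rewrite !mxE.
by case: eqP => // _; rewrite divff // gt_eqF.
Qed.

Lemma dot_jmap Z X Y : dot (G *m (jmap Z *m X)) Y = dot (mu X Y) (H *m Z).
Proof. by rewrite /jmap !mulmxA GGi mul1mx JP. Qed.

Lemma diag_levi_civita : levi_civita (bracket mu) diag_ip diag_nabla.
Proof.
have [_ _ skew] := muV.
have dotZ n a (X Y : 'cV[R]_n) : dot (a *: X) Y = a * dot X Y := dot_scalel a X Y.
split=> [V a U U'|U a V V'|U V|U V W].
- rewrite /diag_nabla !linearP /= jmapZD muZDl scale_col_mx add_col_mx ?mulmxDr -?scalemxAr mulmxDl -scalemxAl.
  by congr col_mx; rewrite !scalerDr !scalerA ![a * _]mulrC ?addrA // -!addrA; congr (_ + _); rewrite addrCA.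
- rewrite /diag_nabla !linearP /= jmapZD muZDr scale_col_mx add_col_mx ?mulmxDr -?scalemxAr mulmxDl -scalemxAl.
  by congr col_mx; rewrite !scalerDr !scalerA ![a * _]mulrC ?addrA // -!addrA; congr (_ + _); rewrite addrCA.
- rewrite /diag_nabla /bracket opp_col_mx add_col_mx; congr col_mx.
    by rewrite [jmap (dsubmx V) *m _ + _]addrC subrr.
  rewrite (skew (usubmx V)) scalerN opprK -scalerDl -[RHS]scale1r.
  by congr (_ *: _); field.
rewrite -[U]vsubmxK -[V]vsubmxK -[W]vsubmxK !diag_nablaE /diag_ip !col_mxKu !col_mxKd.
move: (usubmx U) (dsubmx U) (usubmx V) (dsubmx V) (usubmx W) (dsubmx W) => A C X Z X' Z'.
(* Metric compatibility: [dot_jmap] turns every term into a value of [mu] paired through [H], and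
   skewness cancels them. *)
rewrite -!scalemxAr !dotZ !mulmxDr !dotD !dot_jmap.
rewrite (dot_diagC _ X) (dot_diagC _ Z) (dotC X) (dotC Z).
rewrite -!scalemxAr !dotZ !mulmxDr !dotD !dot_jmap (skew X' X).
rewrite -[- mu X X']scaleN1r dotZ !dot_diagC.
ring.
Qed.

Definition ricci_diag : 'M[R]_(8 + 3) := block_mx (- (3 / 2))%:M 0 0 2%:M.

(** In terms of edge weights, -3 is the vertex sum 3, and the -8 of [ricci2] is the colour sum 4
    with each edge met from both ends; the signs come from skewness. *)
Hypothesis ricci1 : \sum_k h 0 k *: (K k *m Gi *m K k) = - 3 *: G.
Hypothesis ricci2 : forall k l, h 0 k * \tr (Gi *m K k *m Gi *m K l) = - 8 * (k == l)%:R.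

(** The matrix of A |-> [jmap (mu A X) *m Y], which makes the curvature terms accessible to the
    trace. *)
Let M (X Y : 'cV[R]_8) : 'M[R]_8 := \sum_k h 0 k *: (Gi *m K k *m Y *m (X^T *m K k)).

Lemma jmap_mu A X Y : jmap (mu A X) *m Y = M X Y *m A.
Proof.
rewrite jmapE !mulmx_suml; apply: eq_bigr => k _.
rewrite mu_coord -scalerA -!scalemxAl; congr (_ *: _).
by rewrite -[RHS]mulmxA [X^T *m K k *m A in RHS]mx11_scalar mul_mx_scalar.
Qed.

Lemma tr_M X Y : \tr (M X Y) = - 3 * dot (G *m X) Y.
Proof.
transitivity ((X^T *m (\sum_k h 0 k *: (K k *m Gi *m K k)) *m Y) 0 0); last first.
  rewrite ricci1 -scalemxAr -scalemxAl mxE.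
  by rewrite dot_diagC dotC dotE mulmxA.
rewrite /M raddf_sum mulmx_sumr mulmx_suml summxE; apply: eq_bigr => k _.
by rewrite /= mxtraceZ mxtrace_mulC trace_mx11 -scalemxAr -scalemxAl [RHS]mxE !mulmxA.
Qed.

(** A symmetric matrix times a skew one has trace 0. *)
Lemma tr_jmap Z : \tr (jmap Z) = 0.
Proof.
have : \tr (jmap Z) = - \tr (jmap Z).
  rewrite -[LHS]mxtrace_tr /jmap trmx_mul J_skew mulNmx raddfN /= mxtrace_mulC.
  by rewrite /Gi tr_diag_mx.
by lra.
Qed.

Lemma tr_jmap2 Z Z' : \tr (jmap Z *m jmap Z') = - 8 * dot (H *m Z) Z'.
Proof.
rewrite !jmapE mulmx_suml raddf_sum /= dot_diag mulr_sumr; apply: eq_bigr => k _.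
rewrite mulmx_sumr raddf_sum /= (bigD1 k) //= big1 => [|l lk].
  rewrite -scalemxAl -scalemxAr !mxtraceZ !mulmxA addr0.
  have e := ricci2 k k; rewrite eqxx mulr1 in e.
  by transitivity (h 0 k * Z k 0 * Z' k 0 * (h 0 k * \tr (Gi *m K k *m Gi *m K k))); [ring|rewrite e; ring].
have := ricci2 k l; rewrite eq_sym (negPf lk) mulr0 => /eqP.
rewrite mulf_eq0 gt_eqF //= => /eqP t0.
by rewrite -scalemxAl -scalemxAr !mxtraceZ !mulmxA t0 !mulr0.
Qed.

Lemma trace_fun_block (f : 'cV[R]_(8 + 3) -> 'cV[R]_(8 + 3)) (T : 'M[R]_8) :
  (forall A, usubmx (f (col_mx A 0)) = T *m A) ->
  trace_fun f = \tr T + \sum_k dsubmx (f (col_mx 0 (basis_vec R k))) k 0.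
Proof.
move=> fT; rewrite /trace_fun big_split_ord /=; congr (_ + _).
  apply: eq_bigr => i _.
  have -> : basis_vec R (lshift 3 i) = col_mx (basis_vec R i) 0 :> 'cV[R]_(8 + 3).
    apply/matrixP => a b; rewrite !mxE.
    by case: split_ordP => c ->; rewrite !mxE ?eq_lshift ?eq_rlshift.
  have /matrixP/(_ i 0) := fT (basis_vec R i); rewrite mxE => ->.
  by rewrite -colE mxE.
apply: eq_bigr => k _; rewrite [RHS]mxE; congr (f _ _ _).
apply/matrixP => a b; rewrite !mxE.
by case: split_ordP => c ->; rewrite !mxE ?eq_rshift ?eq_lrshift.
Qed.

Lemma curvature_upper A X X' Z Z' :
  usubmx (curvature (bracket mu) diag_nabla (col_mx A 0) (col_mx X Z) (col_mx X' Z')) =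
  (- (1 / 2) *: jmap ((1 / 2) *: mu X X') + 1 / 4 *: M X' X - 1 / 4 *: (jmap Z *m jmap Z') + 1 / 2 *: M X X') *m A.
Proof.
rewrite /curvature /bracket !(diag_nablaE, col_mxKu) !opp_col_mx !add_col_mx !(col_mxKu, col_mxKd).
rewrite !jmap0 !mul0mx !mulmx0 !addr0 !add0r (jmap_mu A X X') !jmapZ -!scalemxAl -!scalemxAr.
rewrite (jmap_mu A X' X) !mulmxDl !mulNmx -!scalemxAl -(mulmxA (jmap Z)).
move: (M X X' *m A) (M X' X *m A) (jmap (mu X X') *m A) (jmap Z *m (jmap Z' *m A)).
by move=> a b c d; apply/matrixP => i j; rewrite !mxE; field.
Qed.

Lemma curvature_lower C X X' Z Z' :
  dsubmx (curvature (bracket mu) diag_nabla (col_mx 0 C) (col_mx X Z) (col_mx X' Z')) =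
  (1 / 4) *: mu X (jmap C *m X').
Proof.
rewrite /curvature /bracket !(diag_nablaE, col_mxKu) !opp_col_mx !add_col_mx !(col_mxKu, col_mxKd).
rewrite !mu0l !(mulmx0, scaler0, add0r, sub0r, subr0, addr0, oppr0) !muZr.
move: (mu X (jmap C *m X')) => m.
by apply/matrixP => i j; rewrite !mxE; field.
Qed.

Lemma diag_ricci_operator : ricci_operator (bracket mu) diag_ip ricci_diag.
Proof.
exists diag_nabla; first exact: diag_levi_civita.
move=> V W; rewrite -[V]vsubmxK -[W]vsubmxK.
move: (usubmx V) (dsubmx V) (usubmx W) (dsubmx W) => X Z X' Z'.
rewrite /ricci_diag mul_block_col !mul0mx addr0 add0r !mul_scalar_mx /diag_ip !col_mxKu !col_mxKd.
rewrite -!scalemxAr !dot_scalel.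
(* On n_1 the trace contributes -3/4 and -3/2 times the product of X and X', on n_2 it contributes
   3/4, in all -3/2; the [jmap] term gives (-1/4)(-8) = 2 times that of Z and Z'. *)
rewrite /ricci_tensor (trace_fun_block (fun A => curvature_upper A X X' Z Z')).
rewrite !raddfD raddfN /= !mxtraceZ tr_jmap !tr_M tr_jmap2.
have -> : \sum_k dsubmx (curvature (bracket mu) diag_nabla (col_mx 0 (basis_vec R k))
     (col_mx X Z) (col_mx X' Z')) k 0 = 3 / 4 * dot (G *m X) X'.
  transitivity (- (1 / 4) * (X'^T *m (\sum_k h 0 k *: (K k *m Gi *m K k)) *m X) 0 0); last first.
    by rewrite ricci1 -scalemxAr -scalemxAl mxE dotE mulmxA; field.
  rewrite mulmx_sumr mulmx_suml summxE mulr_sumr; apply: eq_bigr => k _.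
  have jb : jmap (basis_vec R k) = h 0 k *: (Gi *m K k).
    rewrite jmapE (bigD1 k) //= big1 => [|l lk]; last by rewrite mxE (negPf lk) mulr0 scale0r.
    by rewrite mxE !eqxx mulr1 addr0.
  have KT : (K k)^T = - K k := J_skew _.
  have GiT : Gi^T = Gi by rewrite tr_diag_mx.
  rewrite curvature_lower [LHS]mxE mu_coord jb -scalemxAl linearZ /= !trmx_mul GiT KT.
  rewrite mulNmx mulmxN -scalemxAr -!scalemxAl !mulNmx !mulmxA.
  by move: (_ *m X) => P; rewrite !mxE; field.
by rewrite (dotC (G *m X') X) -dot_diagC; field.
Qed.

Lemma diag_admits_nilsoliton : admits_nilsoliton (bracket mu).
Proof.
exists diag_ip; split; first exact: diag_ip_inner.
exists ricci_diag; split; first exact: diag_ricci_operator.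
exists (- 5), (block_mx (7 / 2)%:M 0 0 7%:M); split.
  move=> U V; rewrite -[U]vsubmxK -[V]vsubmxK.
  move: (usubmx U) (dsubmx U) (usubmx V) (dsubmx V) => A C X Z.
  rewrite /bracket !mul_block_col !col_mxKu !mul0mx !addr0 !mul_scalar_mx add0r ?mulmx0 add_col_mx addr0.
  rewrite scaler0 muZr muZl -scalerDl; by congr (col_mx _ (_ *: _)); field.
rewrite /ricci_diag scalar_mx_block add_block_mx !addr0 -!raddfD /=.
by congr (block_mx _%:M _ _ _%:M); field.
Qed.

End Nilsoliton.

(** * Solving for the edge weights *)

Section Weights.
Variable R : realType.

(* With p = s + 2 s / (1 + s^2) this says (1 + p) (1 + s) = A^2 (1 - p) (1 - s), the condition under
   which the weights of [edge_system] come from an inner product. *)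
Lemma weights_root (A : R) : 1 <= A -> exists s : R,
  [/\ 0 <= s, s < 1, 0 < 1 - 3 * s + s ^+ 2 - s ^+ 3 &
   (1 + 3 * s + s ^+ 2 + s ^+ 3) * (1 + s) = A ^+ 2 * (1 - 3 * s + s ^+ 2 - s ^+ 3) * (1 - s)].
Proof.
move=> A1; have A2 : 1 <= A ^+ 2 by rewrite exprn_ege1.
pose P : {poly R} := (1%:P + 3%:P * 'X + 'X ^+ 2 + 'X ^+ 3) * (1%:P + 'X)
   - (A ^+ 2)%:P * (1%:P - 3%:P * 'X + 'X ^+ 2 - 'X ^+ 3) * (1%:P - 'X).
have PE s : P.[s] = (1 + 3 * s + s ^+ 2 + s ^+ 3) * (1 + s) - A ^+ 2 * (1 - 3 * s + s ^+ 2 - s ^+ 3) * (1 - s).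
  by rewrite /P !(hornerD, hornerN, hornerM, horner_exp, hornerX, hornerC).
(* At 0 the value is 1 - A^2 <= 0; at 1/2 the factor 1 - 3s + s^2 - s^3 is -3/8, so the value is
   positive. *)
have [||s /andP[s0 s12] +] := @poly_ivt R P 0 (1 / 2).
- by lra.
- by rewrite !PE; apply/andP; split; nra.
rewrite rootE PE subr_eq0 => /eqP e; exists s; split=> //; first by lra.
have l : 0 < (1 + 3 * s + s ^+ 2 + s ^+ 3) * (1 + s).
  have := sqr_ge0 s; have := exprn_ge0 3 s0 => h3 h2.
  by apply: mulr_gt0; lra.
by move: l; rewrite e -mulrA pmulr_rgt0 ?pmulr_lgt0 //; lra.
Qed.

(* Here A = - a = - 1 / b.  The weights of the edges are the coefficients 1 +- s, 1 +- p,
   1 +- (s - p) and 1 on the right. *)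
Lemma edge_system (A : R) : 1 <= A -> exists s p hx hy hz g1 g2 g3 g4 g5 g6 g7 g8 : R,
  [/\ [/\ 0 < hx, 0 < hy & 0 < hz],
      [/\ 0 < g1, 0 < g2, 0 < g3 & 0 < g4],
      [/\ 0 < g5, 0 < g6, 0 < g7 & 0 < g8],
      [/\ A ^+ 2 * hx = (1 + p) * g1 * g3, hx = A ^+ 2 * (1 - p) * g2 * g4,
          hx = (1 - s) * g5 * g8 & hx = (1 + s) * g6 * g7] &
      [/\ hy = (1 - s) * g1 * g6, hy = (1 + s) * g2 * g5, hy = (1 - p) * g3 * g7 & hy = (1 + p) * g4 * g8] /\
      [/\ hz = (1 + s - p) * g1 * g8, hz = (1 - s + p) * g2 * g7, hz = g3 * g6 & hz = g4 * g5]].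
Proof.
move=> A1; have [s [s0 s1 de0 e]] := weights_root A1.
have A0 : 0 < A by lra.
(* This [p] gives [1 + s - p = be ^+ 2 / D] and [1 - s + p = al ^+ 2 / D], the ratio that makes the
   edges 18 and 27 compatible. *)
pose D := 1 + s ^+ 2; pose p := s + 2 * s / D; pose de := 1 - p; pose al := 1 + s; pose be := 1 - s.
have D0 : 0 < D by have := sqr_ge0 s; rewrite /D; lra.
have Dn : D != 0 by rewrite gt_eqF.
have al0 : 0 < al by rewrite /al; lra.
have be0 : 0 < be by rewrite /be; lra.
have deE : de = (1 - 3 * s + s ^+ 2 - s ^+ 3) / D by rewrite /de /p /D; field.
have gaE : 1 + p = (1 + 3 * s + s ^+ 2 + s ^+ 3) / D by rewrite /p /D; field.
have {}de0 : 0 < de by rewrite deE divr_gt0.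
have gaal : (1 + p) * al = A ^+ 2 * de * be.
  by rewrite gaE mulrAC e deE /be; field.
(* The witnesses are normalized by [g3 = 1] and [hx = hy = y]; the edges 18 and 27 then both require
   this value of [y ^+ 2]. *)
pose y := Num.sqrt (A * D * de ^+ 3 / al ^+ 3).
have y2 : y ^+ 2 * al ^+ 3 = A * D * de ^+ 3.
  rewrite sqr_sqrtr ?divfK ?gt_eqF ?exprn_gt0 //.
  by rewrite ltW // divr_gt0 ?exprn_gt0 // !mulr_gt0 ?exprn_gt0.
have y0 : 0 < y by rewrite sqrtr_gt0 divr_gt0 ?exprn_gt0 // !mulr_gt0 ?exprn_gt0.
have [An aln ben den yn] : [/\ A != 0, al != 0, be != 0, de != 0 & y != 0] by rewrite !gt_eqF.
exists s, p, y, y, (de / al), (y * al / (be * de)), (y / (A * de)), 1, A^-1, (A * de / al), (de / al), (y / de),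
  (y * al / (A * de * be)).
rewrite -/al -/be -/de.
have gaE2 : 1 + p = A ^+ 2 * de * be / al by rewrite -gaal mulfK.
have rhoE : 1 + s - p = be ^+ 2 / D by rewrite /be /p /D; field.
have sgE : 1 - s + p = al ^+ 2 / D by rewrite /al /p /D; field.
rewrite gaE2 rhoE sgE.
have DE : D = y ^+ 2 * al ^+ 3 / (A * de ^+ 3) by rewrite y2; field; apply/andP.
split.
- by split; do ?[done | apply: divr_gt0 | apply: mulr_gt0].
- by split; rewrite ?ltr01 ?invr_gt0 //; do ?[done | apply: divr_gt0 | apply: mulr_gt0].
- by split; do ?[done | apply: divr_gt0 | apply: mulr_gt0].
- by split; field; rewrite ?An ?aln ?ben ?den ?yn.
- by split; split; rewrite ?DE; clearbody D al be de y; field; rewrite ?An ?aln ?ben ?den ?yn.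
Qed.

Lemma mxtrace_diag_mul n (d : 'rV[R]_n) (B C : 'M[R]_n) :
  \tr (diag_mx d *m B *m diag_mx d *m C) = \sum_i \sum_j d 0 i * B i j * (d 0 j * C j i).
Proof.
apply: eq_bigr => i _; rewrite -!mulmxA mul_diag_mx mxE mxE mulr_sumr.
by apply: eq_bigr => j _; rewrite mul_diag_mx !mxE mulrA.
Qed.

Lemma mul_diag_mulE n (d : 'rV[R]_n) (B C : 'M[R]_n) i j :
  (B *m diag_mx d *m C) i j = \sum_k B i k * d 0 k * C k j.
Proof. by rewrite mul_mx_diag mxE; apply: eq_bigr => k _; rewrite mxE. Qed.

Definition row8 (d1 d2 d3 d4 d5 d6 d7 d8 : R) : 'rV[R]_8 :=
  \row_i [:: d1; d2; d3; d4; d5; d6; d7; d8]`_i.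

(** The matchings are 13, 24, 58, 67 for x, 16, 25, 37, 48 for y and 18, 27, 36, 45 for z; each
    moves diagonal entries along its edges. *)
Lemma Jt_diag t d1 d2 d3 d4 d5 d6 d7 d8 :
  let a := (- t - Num.sqrt (t ^+ 2 - 4)) / 2 in
  let b := (- t + Num.sqrt (t ^+ 2 - 4)) / 2 in
  let D := diag_mx (row8 d1 d2 d3 d4 d5 d6 d7 d8) in
  [/\ Jt t 1 0 0 *m D *m Jt t 1 0 0 =
        - diag_mx (row8 (a ^+ 2 * d3) (b ^+ 2 * d4) (a ^+ 2 * d1) (b ^+ 2 * d2) d8 d7 d6 d5),
      Jt t 0 1 0 *m D *m Jt t 0 1 0 = - diag_mx (row8 d6 d5 d7 d8 d2 d1 d3 d4) &
      Jt t 0 0 1 *m D *m Jt t 0 0 1 = - diag_mx (row8 d8 d7 d6 d5 d4 d3 d2 d1)].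
Proof.
rewrite /Jt; move: (_ / 2) (_ / 2) => a b /=.
split; apply/matrixP => i j; rewrite mul_diag_mulE [RHS]mxE [diag_mx _ i j]mxE.
all: case: i => [[|[|[|[|[|[|[|[|//]]]]]]]] lti]; rewrite !big_ord_recl big_ord0 !mxE /=;
  case: j => [[|[|[|[|[|[|[|[|//]]]]]]]] ltj] /=; by ring.
Qed.

(** Different colours share no edge, which makes the mixed traces in [ricci2] vanish. *)
Lemma Jt_disjoint (t : R) (k l : 'I_3) (i j : 'I_8) : k != l ->
  Jt t (k == 0)%:R (k == 1)%:R (k == 2)%:R i j * Jt t (l == 0)%:R (l == 1)%:R (l == 2)%:R j i = 0.
Proof.
rewrite /Jt; move: (_ / 2) (_ / 2) => a b /=; rewrite !mxE.
case: k l => [[|[|[|//]]] ltk] [[|[|[|//]]] ltl] //= _.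
all: case: i => [[|[|[|[|[|[|[|[|//]]]]]]]] lti];
  case: j => [[|[|[|[|[|[|[|[|//]]]]]]]] ltj] /=; by rewrite !(mulr0, oppr0, mul0r).
Qed.

End Weights.

(** * The nilsoliton metric for [Jt] *)

Section NilsolitonJt.
Variable R : realType.

Lemma Jt_admits_nilsoliton (mu : 'cV[R]_8 -> 'cV[R]_8 -> 'cV[R]_3) t :
  2 <= t -> V38 mu -> (forall x y z : R, J mu (vec3 x y z) = Jt t x y z) ->
  admits_nilsoliton (bracket mu).
Proof.
move=> t2 muV muJ.
pose A := (t + Num.sqrt (t ^+ 2 - 4)) / 2.
have sq : Num.sqrt (t ^+ 2 - 4) ^+ 2 = t ^+ 2 - 4 by rewrite sqr_sqrtr //; nra.
have A1 : 1 <= A by have := sqrtr_ge0 (t ^+ 2 - 4); rewrite /A; lra.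
have An : A != 0 by rewrite gt_eqF //; lra.
have aE : (- t - Num.sqrt (t ^+ 2 - 4)) / 2 = - A by rewrite /A; field.
have bE : (- t + Num.sqrt (t ^+ 2 - 4)) / 2 = - A^-1.
  apply: (mulfI An); rewrite mulrN divff // /A.
  transitivity ((Num.sqrt (t ^+ 2 - 4) ^+ 2 - t ^+ 2) / 4); first by field.
  by rewrite sq; field.
have [s [p [hx [hy [hz [g1 [g2 [g3 [g4 [g5 [g6 [g7 [g8 E]]]]]]]]]]]]] := edge_system A1.
case: E => [[hx0 hy0 hz0] [g10 g20 g30 g40] [g50 g60 g70 g80] [e13 e24 e58 e67]
  [[e16 e25 e37 e48] [e18 e27 e36 e45]]].
have [n1 n2 n3 n4] : [/\ g1 != 0, g2 != 0, g3 != 0 & g4 != 0] by rewrite !gt_eqF.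
have [n5 n6 n7 n8] : [/\ g5 != 0, g6 != 0, g7 != 0 & g8 != 0] by rewrite !gt_eqF.
pose g := row8 g1 g2 g3 g4 g5 g6 g7 g8.
have gV : map_mx GRing.inv g = row8 g1^-1 g2^-1 g3^-1 g4^-1 g5^-1 g6^-1 g7^-1 g8^-1.
  apply/matrixP => i j; rewrite !mxE; case: j => [j ltj] /=.
  by do 8 (destruct j as [|j]; [by []|]).
pose h : 'rV[R]_3 := \row_i [:: hx; hy; hz]`_i.
have KE k : J mu (basis_vec R k) = Jt t (k == 0)%:R (k == 1)%:R (k == 2)%:R.
  rewrite -muJ; congr (J mu _); rewrite [LHS]vec3E !mxE !andbT.
  by rewrite ![k == _]eq_sym.
(* Dividing each edge equation by the value at one endpoint makes the vertex conditions linear: at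
   vertex 1, for example, (1 + p) + (1 - s) + (1 + s - p) = 3. *)
have half (w x y u : R) : u != 0 -> w = x * y * u -> w / u = x * y by move=> un ->; field.
have halfl (w x y u : R) : u != 0 -> w = x * u * y -> w / u = x * y.
    by move=> un ->; field.
have f13 := half _ _ _ _ n3 e13; have f31 := halfl _ _ _ _ n1 e13.
have e24' : A^-1 ^+ 2 * hx = (1 - p) * g2 * g4 by rewrite e24; field.
have f24 := half _ _ _ _ n4 e24'; have f42 := halfl _ _ _ _ n2 e24'.
have f58 := half _ _ _ _ n8 e58; have f85 := halfl _ _ _ _ n5 e58.
have f67 := half _ _ _ _ n7 e67; have f76 := halfl _ _ _ _ n6 e67.
have f16 := half _ _ _ _ n6 e16; have f61 := halfl _ _ _ _ n1 e16.
have f25 := half _ _ _ _ n5 e25; have f52 := halfl _ _ _ _ n2 e25.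
have f37 := half _ _ _ _ n7 e37; have f73 := halfl _ _ _ _ n3 e37.
have f48 := half _ _ _ _ n8 e48; have f84 := halfl _ _ _ _ n4 e48.
have f18 := half _ _ _ _ n8 e18; have f81 := halfl _ _ _ _ n1 e18.
have f27 := half _ _ _ _ n7 e27; have f72 := halfl _ _ _ _ n2 e27.
have f36 : hz / g6 = g3 by rewrite e36; field.
have f63 : hz / g3 = g6 by rewrite e36; field.
have f45 : hz / g5 = g4 by rewrite e45; field.
have f54 : hz / g4 = g5 by rewrite e45; field.
have [dx dy dz] := Jt_diag t g1^-1 g2^-1 g3^-1 g4^-1 g5^-1 g6^-1 g7^-1 g8^-1.
have [K0 K1 K2] : [/\ J mu (basis_vec R ord0) = Jt t 1 0 0,
    J mu (basis_vec R (lift ord0 ord0)) = Jt t 0 1 0 &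
    J mu (basis_vec R (lift ord0 (lift ord0 ord0))) = Jt t 0 0 1] by split; rewrite KE.
apply: (@diag_admits_nilsoliton R mu muV g h).
- by case=> [[|[|[|[|[|[|[|[|//]]]]]]]] lti]; rewrite mxE.
- by case=> [[|[|[|//]]] lti]; rewrite mxE.
- rewrite !big_ord_recl big_ord0 addr0 K0 K1 K2 gV dx dy dz aE bE.
  clear KE K0 K1 K2 aE bE e13 e24 e24' e58 e67 e16 e25 e37 e48 e18 e27 e36 e45 sq half halfl.
  apply/matrixP => i j; rewrite !mxE; case: eqP => [_|_]; last by rewrite !mulr0n; ring.
  case: i => [i lti] /=; rewrite !mulr1n.
  by do 8 (destruct i as [|i]; [by rewrite /=; lra|]).
- move=> k l; have [<-|kl] := eqVneq k l; last first.
  rewrite mxtrace_diag_mul big1 ?mulr0 // => i _; rewrite big1 // => j _.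
    by rewrite mulrACA !KE Jt_disjoint // mulr0.
  (* Dividing by both endpoints gives the weights themselves, whose sum over each colour is 4. *)
  have q13 : A ^+ 2 * hx / g3 / g1 = 1 + p by rewrite f13 mulfK.
  have q24 : A^-1 ^+ 2 * hx / g4 / g2 = 1 - p by rewrite f24 mulfK.
  have q58 : hx / g8 / g5 = 1 - s by rewrite f58 mulfK.
  have q67 : hx / g7 / g6 = 1 + s by rewrite f67 mulfK.
  have q16 : hy / g6 / g1 = 1 - s by rewrite f16 mulfK.
  have q25 : hy / g5 / g2 = 1 + s by rewrite f25 mulfK.
  have q37 : hy / g7 / g3 = 1 - p by rewrite f37 mulfK.
  have q48 : hy / g8 / g4 = 1 + p by rewrite f48 mulfK.
  have q18 : hz / g8 / g1 = 1 + s - p by rewrite f18 mulfK.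
  have q27 : hz / g7 / g2 = 1 - s + p by rewrite f27 mulfK.
  have q36 : hz / g6 / g3 = 1 by rewrite f36 divff.
  have q45 : hz / g5 / g4 = 1 by rewrite f45 divff.
  rewrite gV -!mulmxA [J mu _ *m (_ *m _)]mulmxA mulr1.
  have trE (d r : 'rV[R]_8) : \tr (diag_mx d *m - diag_mx r) = - \sum_i d 0 i * r 0 i.
    by rewrite mulmxN raddfN /= mulmx_diag mxtrace_diag; congr (- _); apply: eq_bigr => i _; rewrite mxE.
  case: k => [[|[|[|//]]] ltk].
  + have -> : J mu (basis_vec R (Ordinal ltk)) = Jt t 1 0 0 by rewrite KE.
    rewrite dx aE bE trE !big_ord_recl big_ord0 !mxE /=.
    clear KE K0 K1 K2 dx dy dz aE bE gV sq t2; lra.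
  + have -> : J mu (basis_vec R (Ordinal ltk)) = Jt t 0 1 0 by rewrite KE.
    rewrite dy trE !big_ord_recl big_ord0 !mxE /=.
    clear KE K0 K1 K2 dx dy dz aE bE gV sq t2; lra.
  + have -> : J mu (basis_vec R (Ordinal ltk)) = Jt t 0 0 1 by rewrite KE.
    rewrite dz trE !big_ord_recl big_ord0 !mxE /=.
    clear KE K0 K1 K2 dx dy dz aE bE gV sq t2; lra.
Qed.
End NilsolitonJt.

(** * Assembly of the four claims *)

Theorem proposition4p2 (R : realType)
    (mu : R -> 'cV[R]_8 -> 'cV[R]_8 -> 'cV[R]_3)
    (muV : forall t : R, 2 <= t -> V38 (mu t))
    (muJ : forall t : R, 2 <= t ->
       forall x y z : R, J (mu t) (vec3 x y z) = Jt t x y z) :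
  [/\ forall s t : R, 2 <= s -> 2 <= t -> s != t ->
        ~ lie_isomorphic (bracket (mu s)) (bracket (mu t)),
      forall t : R, 2 <= t -> nonsingular (mu t),
      forall t : R, 2 <= t -> admits_nilsoliton (bracket (mu t)) &
      exists J0 : 'M[R]_8,
        [/\ skew_mx J0,
            only_eigenvalues_pm_i J0 &
            forall Pf : 'M[R]_8 -> R, pfaffian J0 Pf ->
              forall t : R, 2 <= t -> forall x y z : R,
                pfaffian_form Pf (mu t) x y z =
                x ^+ 4 + y ^+ 4 + z ^+ 4 + t * x ^+ 2 * y ^+ 2]].
Proof.
split=> [s t s2 t2 st iso|t t2|t t2|].
- have [k [L [k0 uL h]]] := isomorphic_quartics s2 t2 (muV s s2) (muV t t2) (muJ s s2) (muJ t t2) iso.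
  by move/eqP: st; apply; apply: quartic_rigid h.
- exact: nonsingular_Jt t2 (muJ t t2).
- exact: Jt_admits_nilsoliton t2 (muV t t2) (muJ t t2).
(* The parameter 2 is an arbitrary choice, by [Jt_010]. *)
exists (Jt 2 0 1 0); split; first exact: Jt_tr.
  exact/only_eigenvalues_of_sq/Jt_010_sq.
move=> Pf PfP t t2 x y z; rewrite /pfaffian_form muJ //.
by apply: pfaffian_Jt => //; rewrite (Jt_010 t 2).
Qed.
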